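(* For each dimension $d\geq 2$ there exist numbers $f(d)$ and $g(d)$ with the following property. Let $\mathcal{F}$ be a finite $(d+1)$-colored family of convex sets in $\mathbb{R}^d$, with color classes $\mathcal{F}_1,\dots,\mathcal{F}_{d+1}$, that satisfies the Colorful Helly property $\mathcal{CH}(\mathcal{F}_1,\dots,\mathcal{F}_{d+1})$. Let $i\in[d+1]$ be a color whose class $\mathcal{F}_i$ has non-empty intersection $\bigcap\mathcal{F}_i\neq\emptyset$ (such a color exists by the Colorful Helly Theorem of Lovász). Then one of the following holds: (1) an additional color class $\mathcal{F}_j$, for some $j\in[d+1]\setminus\{i\}$, can be pierced by $f(d)$ points; or (2) the entire family $\mathcal{F}$ can be crossed by $g(d)$ lines.
   Context: A finite family $\mathcal{F}$ of convex sets is $k$-colored if each set is colored with (at least) one of $k$ colors; $\mathcal{F}=\mathcal{F}_1\cup\dots\cup\mathcal{F}_k$, where $\mathcal{F}_i$ is the class of sets with color $i$. The family has the Colorful Helly property $\mathcal{CH}(\mathcal{F}_1,\dots,\mathcal{F}_k)$ if every rainbow selection $K_i\in\mathcal{F}_i$, $1\le i\le k$, satisfies $\bigcap_{i=1}^k K_i\neq\emptyset$. A collection $X$ of points (resp. lines, $k$-flats) pierces/crosses a family if every set of the family is intersected by some member of $X$. *)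

(* Defs.v *)
From mathcomp Require Import all_boot all_order all_algebra.
From mathcomp Require Import all_classical all_reals all_analysis.

Set Implicit Arguments.
Unset Strict Implicit.
Unset Printing Implicit Defensive.

Import GRing.Theory.

Local Open Scope classical_set_scope.
Local Open Scope card_scope.
Local Open Scope ring_scope.

(* A k-colored family is given by its classes [F : 'I_k -> set (set V)]; the
   classes may overlap, so a set may carry several colors. *)

Definition colored_family (k : nat) (V : Type) (F : 'I_k -> set (set V)) :
    set (set V) :=
  \bigcup_(i in [set: 'I_k]) F i.

Definition colorful_helly (k : nat) (V : Type) (F : 'I_k -> set (set V)) : Prop :=
  forall K : 'I_k -> set V, (forall i, F i (K i)) ->
    \bigcap_(i in [set: 'I_k]) K i !=set0.

Definition is_line (R : realType) (d : nat) (L : set 'rV[R]_d) : Prop :=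
  exists p v : 'rV[R]_d, v != 0 /\ L = [set p + t *: v | t in [set: R]].

(* [X #<= `I_n] says that X has at most n elements; in particular X is finite. *)

Definition pierced_by_points (V : Type) (n : nat) (G : set (set V)) : Prop :=
  exists X : set V, X #<= `I_n /\
    forall K, G K -> exists2 x, X x & K x.

Definition crossed_by_lines (R : realType) (d n : nat)
    (G : set (set 'rV[R]_d)) : Prop :=
  exists X : set (set 'rV[R]_d),
    [/\ X #<= `I_n, forall L, X L -> is_line L &
        forall K, G K -> exists2 L, X L & L `&` K !=set0].

(* Main.v *)
Require Import Defs.
From mathcomp Require Import all_boot all_order all_algebra.
From mathcomp Require Import all_classical all_reals all_analysis.
From mathcomp Require Import zify ring lra.

(** Let the classes other than [F i] not be pierceable by few points. Fix a
    target class [j0 <> i] and eliminate the other classes one by one. If a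
    class [F j] cannot be pierced by few points, the Alon-Kleitman
    (p, d+1)-theorem yields [p] members of [F j] no [d+1] of which share a
    point. Suppose that every rainbow intersection meets one of [m] flats of
    dimension [n+1], and let [p = m d + 1]. A rainbow intersection [M] of the
    remaining classes meets each of the [p] sets inside one of the flats, hence
    meets [d+1] of them inside the same flat. These [d+1] convex sets have no
    common point, so that [M] must cross one of [d+1] hyperplanes of the flat
    separating them. The number of [n]-flats obtained is bounded, and once only
    [F i] and [F j0] are left the flats are lines.

    The (p, d+1)-theorem is proved along the lines of Alon and Kleitman, with the
    points of least norm in place of lexicographic minima in the fractional
    Helly theorem, and multiplicative weights in place of linear programming
    duality. *)

Set Implicit Arguments.
Unset Strict Implicit.
Unset Printing Implicit Defensive.

Import Order.TTheory GRing.Theory Num.Theory.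
Import numFieldNormedType.Exports.

Local Open Scope classical_set_scope.
Local Open Scope ring_scope.

Section Convexity.
Variables (R : realType) (E : lmodType R).
Implicit Types (C : set E).

Lemma convex_setE C :
  convex_set C <->
  (forall x y t, C x -> C y -> 0 <= t -> t <= 1 -> C (t *: x + (1 - t) *: y)).
Proof.
split=> [cC x y t Cx Cy t0 t1|cC x y l].
  have t01 : Itv.spec (@Itv.num_sem R) (Itv.Real `[0%Z, 1%Z]) t.
    by rewrite /= /Itv.num_sem /= num_real in_itv /= t0 t1.
  by have := cC x y (Itv.mk t01); rewrite !inE; apply.
by rewrite !inE => Cx Cy; apply: cC.
Qed.

Lemma convex_setI C D : convex_set C -> convex_set D -> convex_set (C `&` D).
Proof.
move=> /convex_setE cC /convex_setE cD; apply/convex_setE.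
by move=> x y t [Cx Dx] [Cy Dy] t0 t1; split; [exact: cC|exact: cD].
Qed.

Lemma convex_bigcap I (P : set I) (C : I -> set E) :
  (forall i, P i -> convex_set (C i)) -> convex_set (\bigcap_(i in P) C i).
Proof.
move=> cC; apply/convex_setE => x y t Cx Cy t0 t1 i Pi.
by have /convex_setE := cC i Pi; apply=> //; [exact: Cx|exact: Cy].
Qed.

Definition hull (T : finType) (X : T -> E) (S : pred T) : set E :=
  [set x | exists w : T -> R,
    [/\ forall t, 0 <= w t, forall t, ~~ S t -> w t = 0, \sum_t w t = 1 &
        x = \sum_t w t *: X t]].

Lemma hull_convex (T : finType) (X : T -> E) (S : pred T) :
  convex_set (hull X S).
Proof.
apply/convex_setE => _ _ a [w [w0 wS w1 ->]] [v [v0 vS v1 ->]] a0 a1.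
exists (fun t => a * w t + (1 - a) * v t); split=> [t|t St||].
- by rewrite addr_ge0 ?mulr_ge0 ?subr_ge0.
- by rewrite wS ?vS ?mulr0 ?addr0.
- by rewrite big_split /= -!mulr_sumr w1 v1 !mulr1 addrC subrK.
- rewrite !scaler_sumr -big_split /=; apply: eq_bigr => t _.
  by rewrite !scalerA scalerDl.
Qed.

Lemma hull_in (T : finType) (X : T -> E) (S : pred T) (t : T) :
  S t -> hull X S (X t).
Proof.
move=> St; exists (fun s => (s == t)%:R); split=> [s|s Ss||].
- exact: ler0n.
- by case: eqP => // st; move: Ss; rewrite st St.
- by rewrite (bigD1 t) //= eqxx big1 ?addr0 // => s /negbTE ->.
- rewrite (bigD1 t) //= eqxx scale1r big1 ?addr0 // => s /negbTE ->.
  by rewrite scale0r.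
Qed.

Lemma hull_sub (T : finType) (X : T -> E) (S : pred T) C :
  convex_set C -> (forall t, S t -> C (X t)) -> hull X S `<=` C.
Proof.
move=> /convex_setE cC XC _ [w [w0 wS w1 ->]].
have H (s : seq T) : (\sum_(t <- s) w t = 0 /\ \sum_(t <- s) w t *: X t = 0) \/
    (exists2 c, C c & 0 < \sum_(t <- s) w t /\
       \sum_(t <- s) w t *: X t = (\sum_(t <- s) w t) *: c).
  elim: s => [|t s IH]; first by left; rewrite !big_nil.
  rewrite !big_cons; have [wt|wt] := eqVneq (w t) 0.
    by rewrite wt scale0r !add0r.
  have wt0 : 0 < w t by rewrite lt_neqAle eq_sym wt w0.
  have CXt : C (X t).
    by apply: XC; apply: contraT => /wS /eqP; rewrite (negbTE wt).
  right; case: IH => [[-> ->]|[c Cc [W0 ->]]].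
    by exists (X t) => //; rewrite !addr0.
  set W := \sum_(_ <- _) _ in W0 *.
  have tW : 0 < w t + W by exact: addr_gt0.
  exists ((w t / (w t + W)) *: X t + (1 - w t / (w t + W)) *: c).
    apply: cC => //; first by rewrite divr_ge0 // ltW.
    by rewrite ler_pdivrMr // mul1r lerDl ltW.
  split=> //; rewrite scalerDr !scalerA; congr (_ *: _ + _ *: _).
    by rewrite mulrC divfK ?gt_eqF.
  by field; rewrite gt_eqF.
case: (H (index_enum T)) => [[]|[c Cc [_ ->]]].
  by rewrite w1 => /eqP; rewrite oner_eq0.
by rewrite w1 scale1r.
Qed.

Lemma sub_hull (T : finType) (X : T -> E) (S S' : pred T) :
  (forall t, S t -> S' t) -> hull X S `<=` hull X S'.
Proof.
by move=> SS'; apply: hull_sub => [|t /SS']; [exact: hull_convex|exact: hull_in].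
Qed.

(* A weak form of Tverberg's theorem, without control of the number of points. *)
Definition tverberg (G : finType) := exists P : finType, forall X : P -> E,
  exists (c : P -> G) (z : E), forall g, hull X (fun p => c p == g) z.

Lemma tverberg_unit : tverberg unit.
Proof.
exists unit => X; exists id, (X tt) => -[].
exact: (@hull_in _ X _ tt).
Qed.

Lemma tverberg_prod (G H : finType) :
  tverberg G -> tverberg H -> tverberg (G * H)%type.
Proof.
move=> [P TP] [Q TQ]; exists (P * Q)%type => X.
have /choice[c /choice[Y XY]] := fun q => TP (fun p => X (p, q)).
have [e [z Yz]] := TQ Y.
exists (fun pq => (c pq.2 pq.1, e pq.2)), z => -[g h].
move: (z) (Yz h); apply: hull_sub => [|q /eqP eq_h]; first exact: hull_convex.
move: (Y q) (XY q g); apply: hull_sub => [|p /eqP cp]; first exact: hull_convex.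
by apply: (@hull_in _ X _ (p, q)); rewrite /= cp eq_h.
Qed.

End Convexity.

Section Radon.
Variables (R : realType) (d : nat).
Local Notation E := 'rV[R]_d.

Lemma radon (X : 'I_d.+2 -> E) : exists (c : 'I_d.+2 -> bool) (z : E),
  forall b, hull X (fun t => c t == b) z.
Proof.
pose M := row_mx (\matrix_i X i) (const_mx 1 : 'cV[R]_d.+2).
have : kermx M != 0.
  rewrite -mxrank_eq0 mxrank_ker -lt0n subn_gt0 ltnS.
  by rewrite (leq_trans (rank_leq_col _)) // addn1.
case/rowV0Pn => u /sub_kermxP; rewrite mul_mx_row -row_mx0.
case/eq_row_mx => uX /rowP/(_ 0); rewrite !mxE => u1 u0.
have {}u1 : \sum_i u 0 i = 0.
  by rewrite -[RHS]u1; apply: eq_bigr => i _; rewrite mxE mulr1.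
have {}uX : \sum_i u 0 i *: X i = 0.
  by rewrite -[RHS]uX mulmx_sum_row; apply: eq_bigr => i _; rewrite rowK.
pose p i := Num.max (u 0 i) 0; pose n i := Num.max (- u 0 i) 0.
have pn i : p i = n i + u 0 i by rewrite /p /n; do 2!case: ltP => ?; lra.
have p0 i : 0 <= p i by rewrite /p le_max lexx orbT.
have n0 i : 0 <= n i by rewrite /n le_max lexx orbT.
pose s := \sum_i p i.
have sn : \sum_i n i = s.
  by rewrite /s (eq_bigr _ (fun i _ => pn i)) big_split /= u1 addr0.
have s0 : 0 < s.
  rewrite lt_neqAle eq_sym sumr_ge0 // andbT; apply/eqP => s0.
  case/negP: u0; apply/eqP/rowP => i; rewrite mxE.
  have pi0 : p i = 0 by by apply: (psumr_eq0P (P := xpredT)) (i) _.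
  have ni0 : n i = 0.
    by apply: (psumr_eq0P (P := xpredT)) (i) _ => //; rewrite sn.
  by move: (pn i); rewrite pi0 ni0 add0r.
exists (fun i => 0 < u 0 i), (s^-1 *: \sum_i p i *: X i) => -[].
  exists (fun i => s^-1 * p i); split=> [i|i||].
  - by rewrite mulr_ge0 // invr_ge0 ltW.
  - by rewrite eqb_id -leNgt /p => ui; rewrite max_r ?mulr0.
  - by rewrite -mulr_sumr mulVf // gt_eqF.
  - by rewrite scaler_sumr; apply: eq_bigr => i _; rewrite scalerA.
exists (fun i => s^-1 * n i); split=> [i|i||].
- by rewrite mulr_ge0 // invr_ge0 ltW.
- by rewrite eqbF_neg negbK /n => ui; rewrite max_r ?mulr0 // oppr_le0 ltW.
- by rewrite -mulr_sumr sn mulVf // gt_eqF.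
- rewrite (eq_bigr (fun i => n i *: X i + u 0 i *: X i)).
    rewrite big_split /= uX addr0 scaler_sumr.
    by apply: eq_bigr => i _; rewrite scalerA.
  by move=> i _; rewrite pn scalerDl.
Qed.

Lemma helly_points (D : 'I_d.+2 -> set E) (y : 'I_d.+2 -> E) :
  (forall i, convex_set (D i)) -> (forall i j, i != j -> D i (y j)) ->
  exists z, forall i, D i z.
Proof.
move=> cD Dy; have [c [z yz]] := radon y; exists z => i.
move: (z) (yz (~~ c i)); apply: hull_sub => // j /eqP cj.
by apply: Dy; apply: contraTneq isT => ij; move: cj; rewrite ij; case: (c j).
Qed.

Lemma tverberg_exists n : exists2 G : finType, (n < #|G|)%N & tverberg E G.
Proof.
elim: n => [|n [G nG TG]].
  by exists unit; [rewrite card_unit|exact: tverberg_unit].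
exists (bool * G)%type; first by rewrite card_prod card_bool; lia.
by apply: tverberg_prod => //; exists 'I_d.+2; exact: radon.
Qed.

End Radon.

Section MinimalPoint.
Variables (R : realType) (d : nat).
Local Notation E := 'rV[R]_d.
Implicit Types (x y z : E) (C : set E).

Definition dot x y : R := \sum_i x 0 i * y 0 i.
Definition sqn x := dot x x.

Lemma dotDl x y z : dot (x + y) z = dot x z + dot y z.
Proof. by rewrite -big_split; apply: eq_bigr => i _; rewrite mxE mulrDl. Qed.

Lemma dotC x y : dot x y = dot y x.
Proof. by apply: eq_bigr => i _; rewrite mulrC. Qed.

Lemma dotZl a x y : dot (a *: x) y = a * dot x y.
Proof. by rewrite mulr_sumr; apply: eq_bigr => i _; rewrite mxE mulrA. Qed.

Lemma dotDr x y z : dot x (y + z) = dot x y + dot x z.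
Proof. by rewrite dotC dotDl !(dotC x). Qed.

Lemma dotZr a x y : dot x (a *: y) = a * dot x y.
Proof. by rewrite dotC dotZl dotC. Qed.

Lemma dotBr x y z : dot x (y - z) = dot x y - dot x z.
Proof. by rewrite -scaleN1r dotDr dotZr mulN1r. Qed.

Lemma dotBl x y z : dot (x - y) z = dot x z - dot y z.
Proof. by rewrite dotC dotBr !(dotC z). Qed.

Lemma dot0l x : dot 0 x = 0.
Proof. by rewrite -(scale0r 0) dotZl mul0r. Qed.

Lemma sqn_ge0 x : 0 <= sqn x.
Proof. by apply: sumr_ge0 => i _; rewrite -expr2 sqr_ge0. Qed.

Lemma sqn_eq0 x : sqn x = 0 -> x = 0.
Proof.
move=> x0; apply/rowP => i; rewrite mxE; apply/eqP; rewrite -sqrf_eq0 expr2.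
apply/eqP; apply: (psumr_eq0P (P := xpredT) (F := fun i => x 0 i * x 0 i)) => // j _.
by rewrite -expr2 sqr_ge0.
Qed.

Lemma sqn_conv (t : R) x y : sqn (t *: x + (1 - t) *: y) =
  t * sqn x + (1 - t) * sqn y - t * (1 - t) * sqn (x - y).
Proof.
rewrite /sqn !(dotBl, dotBr, dotDl, dotDr, dotZl, dotZr) (dotC y x); ring.
Qed.

Lemma dot_continuous x : continuous (dot x).
Proof.
apply: continuous_big => [|i _]; first exact: add_continuous.
move=> y; apply: continuousM; first exact: cst_continuous.
exact: coord_continuous.
Qed.

Lemma sqn_continuous : continuous sqn.
Proof.
apply: continuous_big => [|i _]; first exact: add_continuous.
by move=> y; apply: continuousM; exact: coord_continuous.
Qed.

Definition is_min C x := C x /\ forall y, C y -> sqn x <= sqn y.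

Lemma is_min_exists C : compact C -> C !=set0 -> exists x, is_min C x.
Proof.
move=> cC C0; have [x Cx xmin] := EVT_min_rV C0 cC
  (continuous_subspaceT sqn_continuous).
by exists x; split=> [|y Cy]; [exact: set_mem|apply: xmin; exact: mem_set].
Qed.

Lemma is_min_inj C x y : convex_set C -> is_min C x -> is_min C y -> x = y.
Proof.
move=> /convex_setE cC [Cx xmin] [Cy ymin].
have h0 : 0 <= 2^-1 :> R by lra.
have h1 : 2^-1 <= 1 :> R by lra.
have := xmin _ (cC _ _ 2^-1 Cx Cy h0 h1); rewrite sqn_conv.
have xy : sqn x = sqn y by apply/eqP; rewrite eq_le xmin ?ymin.
have := sqn_ge0 (x - y); rewrite xy => n0 n1.
apply/eqP; rewrite -subr_eq0; apply/eqP/sqn_eq0; nra.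
Qed.

Lemma is_min_dot C x y : convex_set C -> is_min C x -> C y -> sqn x <= dot x y.
Proof.
move=> /convex_setE cC [Cx xmin] Cy.
have H t : 0 < t -> t <= 1 -> sqn x <= sqn y - (1 - t) * sqn (y - x).
  move=> t0 t1; have := xmin _ (cC _ _ t Cy Cx (ltW t0) t1).
  by rewrite sqn_conv; nra.
have e : sqn y - sqn (y - x) = 2 * dot x y - sqn x.
  by rewrite /sqn !(dotBl, dotBr) (dotC y x); ring.
rewrite leNgt; apply/negP => xy; have s0 := sqn_ge0 (y - x).
pose a := 2 * (sqn x - dot x y); have a0 : 0 < a by rewrite /a; lra.
have sa0 : 0 < sqn (y - x) + a by lra.
pose t := a / (2 * (sqn (y - x) + a)).
have t0 : 0 < t by rewrite divr_gt0 // mulr_gt0.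
have t1 : t <= 1 by rewrite ler_pdivrMr ?mulr_gt0 //; lra.
have ta : t * (2 * (sqn (y - x) + a)) = a by rewrite divfK // gt_eqF // mulr_gt0.
by have := H t t0 t1; rewrite /a in ta *; nra.
Qed.

Definition minpt C : E := xget 0 [set x | is_min C x].

Lemma minptE C x : convex_set C -> is_min C x -> minpt C = x.
Proof.
move=> cC Cx; apply: (is_min_inj cC) => //.
by apply: (xgetPex 0 (P := [set x | is_min C x])); exists x.
Qed.

Lemma hull_compact (T : finType) (X : T -> E) (S : pred T) : compact (hull X S).
Proof.
pose W := [set u : 'rV[R]_#|T| | (forall i, `[0, 1]%classic (u 0 i)) /\
   ((forall t, ~~ S t -> u 0 (enum_rank t) = 0) /\ \sum_i u 0 i = 1)].
have -> : hull X S =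
    (fun u : 'rV[R]_#|T| => \sum_t u 0 (enum_rank t) *: X t) @` W.
  apply/seteqP; split=> [_ [w [w0 wS w1 ->]]|_ [u [u0 [uS u1]] <-]].
    exists (\row_i w (enum_val i)); last first.
      by apply: eq_bigr => t _; rewrite mxE enum_rankK.
    have e : \sum_(i < #|T|) w (enum_val i) = 1 :> R.
      by rewrite -w1; apply/esym/reindex/onW_bij/enum_val_bij.
    split=> [i|]; last split=> [t St|].
    - rewrite /= in_itv /= mxE w0 -w1 (bigD1 (enum_val i)) //= lerDl.
      exact: sumr_ge0.
    - by rewrite mxE enum_rankK wS.
    - by apply: etrans e; apply: eq_bigr => i _; rewrite mxE.
  exists (fun t => u 0 (enum_rank t)); split=> //.
  - by move=> t; have := u0 (enum_rank t); rewrite /= in_itv /= => /andP[].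
  - by rewrite -u1; apply/esym/reindex/onW_bij/enum_rank_bij.
apply: continuous_compact.
  apply: continuous_subspaceT; apply: continuous_big => [|t _].
    exact: add_continuous.
  by move=> u; apply: continuousZ; [exact: coord_continuous|exact: cst_continuous].
have cbox : compact [set u : 'rV[R]_#|T| | forall i, `[0, 1]%classic (u ord0 i)].
  by apply: (@rV_compact R #|T| (fun=> `[0, 1]%classic)) => i; exact: segment_compact.
apply: (subclosed_compact _ cbox); last by move=> u [].
rewrite (_ : W = [set u | forall i, `[0, 1]%classic (u ord0 i)] `&`
  (\bigcap_(t in [set t | ~~ S t]) [set u | u 0 (enum_rank t) = 0] `&`
   [set u | \sum_i u 0 i = 1])); last first.
  by apply/seteqP; split=> u [u0 [uS u1]].
apply: closedI.
  by apply: compact_closed => //; exact: norm_hausdorff.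
apply: closedI.
  apply: closed_bigI => t _.
  have /continuous_closedP := @coord_continuous R 1 #|T| 0 (enum_rank t).
  by move=> /(_ [set 0]); apply; exact: closed_eq.
suff /continuous_closedP/(_ [set 1]) : continuous (fun u : 'rV[R]_#|T| => \sum_i u 0 i).
  by apply; exact: closed_eq.
apply: continuous_big => [|i _]; first exact: add_continuous.
exact: coord_continuous.
Qed.

(* Minimality of [v] says that the intersection of the sets misses the open
   ball of radius [|v|]; by Helly's theorem some [d] of them already do. *)
Lemma minpt_omit_one (C : 'I_d.+1 -> set E) :
  (forall i, convex_set (C i)) -> (forall i, compact (C i)) ->
  (exists x, forall i, C i x) ->
  exists j, C j (minpt (\bigcap_(i in [set i | i != j]) C i)).
Proof.
move=> cC kC [x0 Cx0].
have [v [Cv vmin]] : exists v, is_min (\bigcap_i C i) v.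
  apply: is_min_exists; last by exists x0 => i _.
  rewrite (_ : \bigcap_i C i = C ord0 `&` \bigcap_i C i); last first.
    by apply/seteqP; split=> [x Cx|x []//]; split=> //; exact: Cx.
  apply: compact_closedI; first exact: kC.
  by apply: closed_bigI => i _; apply: compact_closed; [exact: norm_hausdorff|].
pose B := [set x | sqn x < sqn v].
apply: contrapT => noj.
have /choice[y yP] j : exists y, sqn y < sqn v /\ forall i, i != j -> C i y.
  apply: contrapT => noy; apply: noj; exists j.
  rewrite (@minptE _ v); first exact: Cv.
    by apply: convex_bigcap => i _.
  split=> [i _|z Cz]; first exact: Cv.
  by rewrite leNgt; apply/negP => zv; apply: noy; exists z; split=> // i /Cz.
pose D i := if unlift ord_max i is Some k then C k else B.
pose p i := if unlift ord_max i is Some k then y k else v.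
have [||z Dz] := @helly_points R d D p.
- move=> i; rewrite /D; case: unliftP => [k _|_]; first exact: cC.
  apply/convex_setE => a b t Ba Bb t0 t1; rewrite /B /= in Ba Bb *.
  rewrite sqn_conv; have s0 := sqn_ge0 (a - b).
  have [->|t1'] := eqVneq t 1; first by lra.
  have {t1'} u0 : 0 < 1 - t by rewrite subr_gt0 lt_neqAle t1' t1.
  have : 0 <= t * (1 - t) * sqn (a - b) by rewrite !mulr_ge0 // ltW.
  nra.
- move=> i j; rewrite /D /p; case: unliftP => [k ->|->]; case: unliftP => [l ->|->].
  + by move=> kl; apply: (yP l).2; apply: contra kl => /eqP ->.
  + by move=> _; exact: Cv.
  + by move=> _; exact: (yP l).1.
  + by rewrite eqxx.
- have := Dz ord_max; rewrite /D unlift_none /B /= ltNge => /negP; apply.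
  by apply: vmin => i _; have := Dz (lift ord_max i); rewrite /D liftK.
Qed.

End MinimalPoint.

Section Separation.
Variables (R : realType) (d : nat).
Local Notation E := 'rV[R]_d.

Lemma gordan (T : finType) (X : T -> E) :
  ~ hull X xpredT 0 -> exists phi : E, forall t, 0 < dot phi (X t).
Proof.
move=> X0; have [t0 _|T0] := pickP (@predT T); last first.
  by exists 0 => t; have := T0 t.
have [|z zmin] := is_min_exists (@hull_compact R d T X xpredT).
  by exists (X t0); exact: hull_in.
exists z => t; have := is_min_dot (@hull_convex _ _ _ X _) zmin (@hull_in _ _ _ X xpredT t isT).
apply: lt_le_trans; rewrite lt_neqAle sqn_ge0 andbT eq_sym.
by apply: contra_notN X0 => /eqP/sqn_eq0 <-; exact: zmin.1.
Qed.

Lemma nonneg_functional (D : set E) : convex_set D -> D !=set0 -> ~ D 0 ->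
  exists2 phi : E, phi != 0 & forall x, D x -> 0 <= dot phi x.
Proof.
move=> cD [x0 Dx0] D0; pose S := [set phi : E | `|phi| = 1].
have Sclosed : closed S.
  have /continuous_closedP := @norm_continuous R E.
  by move=> /(_ [set 1]); apply; exact: closed_eq.
have cS : compact S.
  apply: bounded_closed_compact => //; exists 1; split=> // M M1 phi /= ->.
  exact: ltW.
have := cS; rewrite compact_In0 => /(_ E D (fun x => S `&` [set phi | 0 <= dot phi x])).
case.
- exists (fun x => [set phi | 0 <= dot phi x]) => // x _.
  have /continuous_closedP/(_ [set r | 0 <= r]) := @dot_continuous R d x.
  move=> /(_ (@closed_ge R 0)); congr closed.
  by apply/seteqP; split=> phi /=; rewrite dotC.
- move=> A AD; pose T := seq_sub (x0 :: finmap.enum_fset A).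
  have [|phi phiP] := @gordan T (fun t => val t).
    apply: contra_not D0; apply: hull_sub => // t _.
    have /predU1P[->//|tA] : val t \in x0 :: finmap.enum_fset A by exact: (valP t).
    by have := AD _ tA; rewrite inE.
  have pos x : x \in x0 :: finmap.enum_fset A -> 0 < dot phi x.
    by move=> xA; exact: (phiP (SeqSub xA)).
  have phi0 : 0 < `|phi|.
    rewrite normr_gt0; apply/eqP => p0; have := pos x0 (mem_head _ _).
    by rewrite p0 dot0l ltxx.
  exists (`|phi|^-1 *: phi) => x xA; split=> /=.
    by rewrite /S /= normrZ normfV normr_id mulVf // gt_eqF.
  rewrite dotZl mulr_ge0 ?invr_ge0 //; apply: ltW; apply: pos.
  by rewrite inE; apply/orP; right.
- move=> phi phiP; exists phi => [|x Dx]; last by have [] := phiP x Dx.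
  have [/= p1 _] := phiP _ Dx0.
  by rewrite -normr_gt0 (_ : `|phi| = 1) ?ltr01.
Qed.

Lemma separation (A B : set E) : convex_set A -> convex_set B ->
  A !=set0 -> B !=set0 -> A `&` B = set0 ->
  exists (phi : E) (c : R), [/\ phi != 0, forall x, A x -> dot phi x <= c &
     forall x, B x -> c <= dot phi x].
Proof.
move=> /convex_setE cA /convex_setE cB [a Aa] [b Bb] AB.
have [|||phi phi0 phiP] := @nonneg_functional [set y - x | x in A & y in B].
- apply/convex_setE => _ _ t [x Ax [y By <-]] [x' Ax' [y' By' <-]] t0 t1.
  exists (t *: x + (1 - t) *: x'); first exact: cA.
  exists (t *: y + (1 - t) *: y'); first exact: cB.
  by rewrite !scalerBr opprD addrACA.
- by exists (b - a); exists a => //; exists b.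
- move=> [x Ax [y By /eqP]]; rewrite subr_eq0 => /eqP yx.
  by suff : set0 x by []; rewrite -AB; split=> //; rewrite -yx.
have le x y : A x -> B y -> dot phi x <= dot phi y.
  move=> Ax By; rewrite -subr_ge0 -dotBr; apply: phiP.
  by exists x => //; exists y.
exists phi, (sup (dot phi @` A)); split=> // [x Ax|y By].
  apply: ub_le_sup; last by exists x.
  by exists (dot phi b) => _ [z Az <-]; exact: le.
apply: ge_sup; first by exists (dot phi a), a.
by move=> _ [z Az <-]; exact: le.
Qed.

End Separation.

Section Counting.

Lemma card_sum_pred (U : finType) (Q : pred U) : #|Q| = (\sum_u Q u)%N.
Proof. by rewrite -sum1_card big_mkcond; apply: eq_bigr => u _; rewrite unfold_in; case: (Q u). Qed.

Lemma pigeonhole (U C : finType) (P : C -> pred U) :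
  (forall u, exists c, P c u) -> (0 < #|U|)%N ->
  exists c, (#|U| <= #|C| * #|P c|)%N.
Proof.
move=> UP U0; apply: contrapT => noc.
have lt c : (#|C| * #|P c| < #|U|)%N.
  by rewrite ltnNge; apply/negP => le; apply: noc; exists c.
have [c0 _] : exists c0 : C, True.
  by case/card_gt0P: U0 => u _; have [c _] := UP u; exists c.
have cover : (#|U| <= \sum_c #|P c|)%N.
  rewrite -sum1_card; under [leqRHS]eq_bigr do rewrite card_sum_pred.
  rewrite exchange_big; apply: leq_sum => u _.
  by have [c Pc] := UP u; rewrite (bigD1 c) //= Pc.
have : (\sum_c #|C| * #|P c| < \sum_(c : C) #|U|)%N.
  rewrite (bigD1 c0) //= [ltnRHS](bigD1 c0) //= -addSn leq_add //.
  by apply: leq_sum => c _; exact: ltnW.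
by rewrite -big_distrr sum_nat_const ltn_mul2l => /andP[_]; rewrite ltnNge cover.
Qed.

(* [(h u v, g u v)] rearranges [U * V], so that for fixed [v] the value
   [h u v] is as random as [u]. *)
Lemma average (U V : finType) (h : U -> V -> U) (g : U -> V -> V)
    (Q : pred U) (c : nat) :
  injective (fun p => (h p.1 p.2, g p.1 p.2)) ->
  (0 < #|U|)%N -> (#|U| <= c * #|Q|)%N ->
  exists u, (#|V| <= c * #|[pred v | Q (h u v)]|)%N.
Proof.
move=> inj U0 UQ; apply: contrapT => nou.
have lt u : (c * #|[pred v | Q (h u v)]| < #|V|)%N.
  by rewrite ltnNge; apply/negP => le; apply: nou; exists u.
have eqQ : (\sum_u #|[pred v | Q (h u v)]| = #|V| * #|Q|)%N.
  under eq_bigr do rewrite card_sum_pred.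
  rewrite pair_big /= -(reindex_inj (h := fun p => (h p.1 p.2, g p.1 p.2))
    (P := xpredT) (F := fun p => nat_of_bool (Q p.1))) //=.
  rewrite -(pair_big xpredT xpredT (fun u (_ : V) => nat_of_bool (Q u))) /=.
  under eq_bigr do rewrite sum_nat_const.
  by rewrite -big_distrr -card_sum_pred.
have [u0 _] := card_gt0P U0.
have : (\sum_u c * #|[pred v | Q (h u v)]| < \sum_(u : U) #|V|)%N.
  rewrite (bigD1 u0) //= [ltnRHS](bigD1 u0) //= -addSn leq_add //.
  by apply: leq_sum => u _; exact: ltnW.
rewrite -big_distrr /= sum_nat_const eqQ mulnCA mulnC ltn_mul2r => /andP[_].
by rewrite ltnNge UQ.
Qed.

Lemma bernoulli_nat m n : ((m + n) * m ^ n <= m * m.+1 ^ n)%N.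
Proof.
elim: n => [|n IH]; first by rewrite addn0.
have -> : (m * m.+1 ^ n.+1 = m * m.+1 ^ n * m.+1)%N by rewrite expnSr mulnA.
apply: leq_trans (leq_mul IH (leqnn m.+1)).
rewrite expnS; nia.
Qed.

Lemma double_expn_le m : (0 < m)%N -> (2 * m ^ m.+1 <= m.+1 ^ m.+1)%N.
Proof.
move=> m0; rewrite -(leq_pmul2l m0).
apply: leq_trans (bernoulli_nat m m.+1); rewrite mulnA leq_mul2r; lia.
Qed.

End Counting.

Section MultiplicativeWeights.
Variables (E : Type) (I : finType) (K : I -> set E) (c : nat).

Definition hits (x : E) : pred I := fun k => `[< K k x >].

Hypothesis heavy : forall (T : finType) (pi : T -> I), (0 < #|T|)%N ->
  exists x, (#|T| <= c * #|[pred t | hits x (pi t)]|)%N.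

Let card_tag (w : I -> nat) (Q : pred I) :
  #|[pred t : {k : I & 'I_(w k)} | Q (tag t)]| = (\sum_(k | Q k) w k)%N.
Proof.
transitivity (\sum_(k | Q k) \sum_(j : 'I_(w k)) 1)%N.
  by rewrite (sig_big_dep Q) -sum1_card; apply: eq_bigl => t; rewrite andbT.
by apply: eq_bigr => k _; rewrite sum1_card card_ord.
Qed.

Lemma heavy_weighted (w : I -> nat) : (0 < \sum_k w k)%N ->
  exists x, (\sum_k w k <= c * \sum_(k | hits x k) w k)%N.
Proof.
move=> w0; have cT : #|{: {k : I & 'I_(w k)}}| = (\sum_k w k)%N.
  by rewrite -[RHS](card_tag w xpredT).
have [|x] := heavy (@tag _ (fun k => 'I_(w k))); first by rewrite cT.
by rewrite cT card_tag; exists x.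
Qed.

Let h (s : seq E) k := count (fun x => hits x k) s.

Let h_size s k : (h s k <= size s)%N.
Proof. exact: count_size. Qed.

Lemma weights_decay n t : (0 < c)%N -> (0 < #|I|)%N -> (t <= n)%N ->
  exists s : seq E, size s = t /\
   ((2 * c) ^ t * \sum_k 2 ^ (n - h s k) <= (2 * c).-1 ^ t * (#|I| * 2 ^ n))%N.
Proof.
move=> c0 I0; elim: t => [|t IH] tn.
  exists [::]; split=> //; rewrite !mul1n.
  by under eq_bigr do rewrite /h /= subn0; rewrite sum_nat_const.
have [s [ss IHs]] := IH (ltnW tn).
pose w k := (2 ^ (n - h s k))%N.
have [|x] := @heavy_weighted w.
  have [k0 _] := card_gt0P I0.
  by rewrite (bigD1 k0) //= addn_gt0 expn_gt0.
set W := (\sum_k w k)%N in IHs *; set H := (\sum_(k | hits x k) w k)%N => WH.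
exists (x :: s); split; first by rewrite /= ss.
have : (2 * \sum_k 2 ^ (n - h (x :: s) k) = 2 * W - H)%N.
  rewrite big_distrr /= /W /H [X in (_ - X)%N]big_mkcond big_distrr /=.
  rewrite -sumnB => [|k _]; last by rewrite /w; case: ifP => // _; lia.
  apply: eq_bigr => k _; rewrite /h /= -/(h s k) /w.
  have : (h s k < n)%N by rewrite (leq_ltn_trans (h_size s k)) ?ss.
  case: ifP => _ hn; last by rewrite add0n subn0.
  have -> : (n - h s k = (n - (true + h s k)).+1)%N by rewrite add1n; lia.
  by rewrite expnS; move: (2 ^ _)%N => x2; lia.
set W' := (\sum_k _)%N => eW'.
have step : ((2 * c) * W' <= (2 * c).-1 * W)%N.
  have [m mc] : exists m, (2 * c = m.+1)%N by exists (2 * c).-1; lia.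
  have e1 : (2 * c * W' = c * (2 * W) - c * H)%N by rewrite -mulnBr -eW' mulnCA mulnA.
  have e2 : (c * (2 * W) = m * W + W)%N by rewrite mulnA (mulnC c) mc mulSn addnC.
  by rewrite e1 e2 mc leq_subLR addnC leq_add2r.
rewrite !expnSr -mulnA (leq_trans (leq_mul (leqnn _) step)) //.
by rewrite mulnCA mulnAC mulnC leq_mul2r IHs orbT.
Qed.

(* Each heavy point halves the weights of the sets that it hits; as the total
   weight decays geometrically, no set keeps too large a weight. *)
Lemma fractional_transversal : (0 < c)%N -> (0 < #|I|)%N ->
  exists (n : nat) (X : 'I_n -> E), (0 < n)%N /\
    forall k, (n <= 4 * c * #|[pred a | `[< K k (X a) >]]|)%N.
Proof.
move=> c0 I0; pose S := #|I|; pose m := (2 * c).-1.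
have mc : m.+1 = (2 * c)%N by rewrite /m; lia.
have m0 : (0 < m)%N by lia.
pose n := (4 * c * S)%N.
have [s [ss Hs]] := weights_decay c0 I0 (leqnn n).
have n0 : (0 < n)%N by rewrite !muln_gt0 c0.
exists n, (tnth (in_tuple s) \o cast_ord (esym ss)); split=> // k.
have -> : #|[pred a | `[< K k ((tnth (in_tuple s) \o cast_ord (esym ss)) a) >]]|
    = h s k.
  rewrite /h -sum1_card -sum1_count [RHS]big_tnth.
  rewrite [RHS](reindex (cast_ord (esym ss))) //=.
  by apply: onW_bij; exists (cast_ord ss); [exact: cast_ordKV|exact: cast_ordK].
rewrite leq_mul2l; apply/orP; right; rewrite leqNgt; apply/negP => hS.
have nn : n = (m.+1 * (2 * S))%N by rewrite mc /n; lia.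
have key : (4 ^ S * m ^ n <= m.+1 ^ n)%N.
  rewrite -[4%N]/(2 ^ 2)%N -expnM nn !(expnM _ m.+1) -expnMn.
  by rewrite leq_exp2r ?muln_gt0 // double_expn_le.
have hn : (h s k <= n)%N by rewrite -ss.
have {}Hs : (m.+1 ^ n * 2 ^ (n - h s k) <= m ^ n * (S * 2 ^ n))%N.
  apply: leq_trans Hs; rewrite -mc leq_mul2l; apply/orP; right.
  by rewrite (bigD1 k) //= leq_addr.
have e2 : (2 ^ n = 2 ^ (n - h s k) * 2 ^ h s k)%N by rewrite -expnD subnK.
have lt2 : (2 ^ h s k <= 2 ^ S)%N by rewrite leq_exp2l // ltnW.
have p2 : (0 < 2 ^ (n - h s k))%N by rewrite expn_gt0.
have pm : (0 < m ^ n)%N by rewrite expn_gt0 m0.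
have : (4 ^ S * m ^ n * 2 ^ (n - h s k) <= m ^ n * (S * 2 ^ S) * 2 ^ (n - h s k))%N.
  apply: leq_trans (leq_mul key (leqnn _)) _; apply: leq_trans Hs _.
  rewrite e2 -!mulnA leq_mul2l; apply/orP; right; rewrite leq_mul2l.
  by apply/orP; right; rewrite mulnC leq_mul2r lt2 orbT.
rewrite leq_pmul2r // mulnC leq_pmul2l // -[4%N]/(2 * 2)%N expnMn.
by rewrite leq_pmul2r ?expn_gt0 // leqNgt ltn_expl.
Qed.

End MultiplicativeWeights.

Section PqTheorem.
Variables (R : realType) (d : nat).
Local Notation E := 'rV[R]_d.

Lemma eq_hull (T : finType) (X Y : T -> E) (S : pred T) :
  (forall t, S t -> X t = Y t) -> hull X S = hull Y S.
Proof.
move=> XY; apply/seteqP; split.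
  by apply: hull_sub => [|t St]; [exact: hull_convex|rewrite XY //; exact: hull_in].
by apply: hull_sub => [|t St]; [exact: hull_convex|rewrite -XY //; exact: hull_in].
Qed.

(* Fractional Helly: average, over all but one of the sets, the incidence
   between a set and the least point of [d] others given by [minpt_omit_one]. *)
Lemma heavy_point (p : nat) (I T : finType) (K : I -> set E) (pi : T -> I) :
  (forall k, convex_set (K k)) -> (forall k, compact (K k)) ->
  (forall L : 'I_p -> I, exists2 J : 'I_d.+1 -> 'I_p, injective J &
     exists x, forall k, K (L (J k)) x) ->
  (0 < #|T|)%N ->
  exists x, (#|T| <= #|{: {ffun 'I_d.+1 -> 'I_p} * 'I_d.+1}| *
                     #|[pred t | `[< K (pi t) x >]]|)%N.
Proof.
move=> cK kK pK T0.
pose v (u : {ffun 'I_p -> T}) (J : {ffun 'I_d.+1 -> 'I_p}) j :=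
  minpt (\bigcap_(k in [set k | k != j]) K (pi (u (J k)))).
have U0 : (0 < #|{: {ffun 'I_p -> T}}|)%N by rewrite card_ffun expn_gt0 T0.
pose good (Jj : {ffun 'I_d.+1 -> 'I_p} * 'I_d.+1) : pred {ffun 'I_p -> T} :=
  fun u => injectiveb Jj.1 && `[< K (pi (u (Jj.1 Jj.2))) (v u Jj.1 Jj.2) >].
have [|[J j] Jj] := @pigeonhole _ _ good _ U0.
  move=> u; have [J injJ [x Kx]] := pK (pi \o u).
  have [|||j Kj] := @minpt_omit_one R d (fun k => K (pi (u (J k)))).
  - by move=> k; exact: cK.
  - by move=> k; exact: kK.
  - by exists x.
  exists (finfun J, j); apply/andP; split; last first.
    apply/asboolP; rewrite /v /= ffunE; congr (K _ _): Kj.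
    by congr minpt; apply: eq_bigcapr => k _; rewrite ffunE.
  by apply/injectiveP => k l; rewrite !ffunE; exact: injJ.
have injJ : injective J.
  apply/injectiveP; apply: contraTT U0 => nJ; rewrite -leqNgt.
  apply: leq_trans Jj _; rewrite leqn0 muln_eq0; apply/orP; right.
  by apply/eqP/eq_card0 => u; rewrite unfold_in /good /= (negbTE nJ).
pose h (u : {ffun 'I_p -> T}) (t : T) := [ffun i => if i == J j then t else u i].
pose g (u : {ffun 'I_p -> T}) (t : T) := u (J j).
have [|u0 ut] := @average _ _ h g (good (J, j)) _ _ U0 Jj.
  move=> [u s] [u' s'] [/ffunP uu ss]; congr pair; last first.
    by have := uu (J j); rewrite !ffunE eqxx.
  apply/ffunP => i; have := uu i; rewrite !ffunE; case: eqP => [-> _|//].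
  exact: ss.
exists (v u0 J j); apply: leq_trans ut _; rewrite leq_mul2l; apply/orP; right.
apply: subset_leq_card; apply/fintype.subsetP => t.
rewrite !inE => /andP[_] /asboolP /=; rewrite ffunE eqxx => Kv.
have -> : v u0 J j = v (h u0 t) J j; last exact: Kv.
rewrite /v; congr minpt; apply: eq_bigcapr => k kj.
by rewrite ffunE (inj_eq injJ) (negbTE kj).
Qed.

(* Tverberg parts of a random tuple are hulls with a common point, to which
   [minpt_omit_one] applies; averaging over the omitted part fixes the point. *)
Lemma selection : exists (P : finType) (c : nat), forall (A : finType) (X : A -> E),
  (0 < #|A|)%N -> exists x, (#|{: {ffun P -> A}}| <=
    c * #|[pred t : {ffun P -> A} | `[< hull (X \o t) xpredT x >]]|)%N.
Proof.
have [G dG [P TP]] := tverberg_exists R d d.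
pose e (k : 'I_d.+1) : G := enum_val (widen_ord dG k).
have inje : injective e.
  by move=> k l /enum_val_inj /(congr1 val) /= kl; exact: val_inj.
exists P, #|{: {ffun P -> G} * 'I_d.+1}| => A X A0.
have U0 : (0 < #|{: {ffun P -> A}}|)%N by rewrite card_ffun expn_gt0 A0.
pose C (u : {ffun P -> A}) (c : {ffun P -> G}) k :=
  hull (X \o u) (fun p => c p == e k).
pose v u c j := minpt (\bigcap_(k in [set k | k != j]) C u c k).
pose good (cj : {ffun P -> G} * 'I_d.+1) : pred {ffun P -> A} :=
  fun u => `[< C u cj.1 cj.2 (v u cj.1 cj.2) >].
have [|[c j] cj] := @pigeonhole _ _ good _ U0.
  move=> u; have [c [z cz]] := TP (X \o u).
  have [|||j Cj] := @minpt_omit_one R d (C u (finfun c)).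
  - by move=> k; exact: hull_convex.
  - by move=> k; exact: hull_compact.
  - exists z => k; move: (z) (cz (e k)); apply: sub_hull => p.
    by rewrite ffunE.
  by exists (finfun c, j); apply/asboolP.
pose h (u t : {ffun P -> A}) := [ffun p => if c p == e j then t p else u p].
pose g (u t : {ffun P -> A}) := [ffun p => if c p == e j then u p else t p].
have [|u0 ut] := @average _ _ h g (good (c, j)) _ _ U0 cj.
  move=> [u t] [u' t'] [/ffunP uu /ffunP tt]; congr pair; apply/ffunP => p.
    by have := uu p; have := tt p; rewrite !ffunE; case: ifP.
  by have := uu p; have := tt p; rewrite !ffunE; case: ifP.
exists (v u0 c j); apply: leq_trans ut _; rewrite leq_mul2l; apply/orP; right.
apply: subset_leq_card; apply/fintype.subsetP => t.
rewrite !inE /= => Cv.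
have ev : v (h u0 t) c j = v u0 c j.
  rewrite /v; congr minpt; apply: eq_bigcapr => k kj.
  apply: eq_hull => p /eqP cp; rewrite /= ffunE cp (inj_eq inje).
  by rewrite (negbTE kj).
rewrite ev in Cv; move: (v _ _ _) Cv => x.
rewrite /C (_ : hull _ _ = hull (X \o t) (fun p => c p == e j)).
  exact: sub_hull.
by apply: eq_hull => p cp; rewrite /= ffunE cp.
Qed.

(* Greedy: a point selected inside a missed set [C] lies in many hulls of tuples
   from [C], all of them missed so far. *)
Lemma weak_net (b : nat) : exists f : nat, forall (A : finType) (X : A -> E),
  exists s : seq E, (size s <= f)%N /\ forall C : set E, convex_set C ->
    (0 < #|A| <= b * #|[pred a | `[< C (X a) >]]|)%N -> exists2 x, x \in s & C x.
Proof.
have [P [c sel]] := selection; pose M := (b ^ #|P| * c)%N.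
exists M.+1 => A X; have [A0|A0] := posnP #|A|.
  by exists [::]; split=> // C _; rewrite A0.
pose W := (#|A| ^ #|P|)%N; have W0 : (0 < W)%N by rewrite expn_gt0 A0.
pose miss (s : seq E) : pred {ffun P -> A} :=
  fun t => ~~ `[< exists2 x, x \in s & hull (X \o t) xpredT x >].
pose net (s : seq E) := forall C : set E, convex_set C ->
  (#|A| <= b * #|[pred a | `[< C (X a) >]]|)%N -> exists2 x, x \in s & C x.
have step s : ~ net s -> exists x, (W + M * #|miss (x :: s)| <= M * #|miss s|)%N.
  move=> /existsNP[C /not_implyP[cC /not_implyP[bC Cs]]].
  pose B := {a : A | `[< C (X a) >]}.
  have cB : #|{: B}| = #|[pred a | `[< C (X a) >]]| by rewrite card_sig.
  have B0 : (0 < #|{: B}|)%N.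
    by move: (leq_trans A0 bC); rewrite cB muln_gt0 => /andP[].
  have [x xsel] := sel B (X \o val) B0; exists x.
  pose Q := [pred t : {ffun P -> B} | `[< hull ((X \o val) \o t) xpredT x >]].
  have WQ : (W <= M * #|Q|)%N.
    rewrite /M -mulnA; apply: leq_trans (leq_mul (leqnn _) xsel).
    rewrite /W card_ffun -expnMn cB; have [->|P0] := posnP #|P|; first by rewrite !expn0.
    by rewrite leq_exp2r.
  apply: leq_trans (leq_add WQ (leqnn _)) _.
  rewrite -mulnDr leq_mul2l; apply/orP; right.
  pose lift (t : {ffun P -> B}) : {ffun P -> A} := [ffun p => val (t p)].
  have injl : injective lift.
    by move=> t t' /ffunP tt; apply/ffunP => p; have := tt p; rewrite !ffunE => /val_inj.
  rewrite -(card_imset Q injl) -[#|miss (x :: s)|]cardsE.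
  have eX t : X \o lift t = (X \o val) \o t.
    by apply/funext => p; rewrite /= ffunE.
  rewrite -cardsUI (_ : _ :&: _ = finset.set0) ?cards0 ?addn0.
    apply: subset_leq_card; apply/fintype.subsetP => t.
    rewrite !inE => /orP[/imsetP[t' /asboolP Qt' ->]|].
      apply/asboolPn => -[y ys]; rewrite eX => yt; apply: Cs; exists y => //.
      apply: hull_sub yt => // p _; exact/asboolP/(valP (t' p)).
    apply: contra => /asboolP[y ys yt]; apply/asboolP.
    by exists y => //; rewrite inE ys orbT.
  apply/finset.setP => t; rewrite !inE; apply/negP => /andP[/imsetP[t' /asboolP Qt' ->]].
  by apply/negP; rewrite negbK; apply/asboolP; exists x; rewrite ?mem_head ?eX.
have greedy n : (exists2 s, (size s <= n)%N & net s) \/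
    (exists s, (size s <= n)%N /\ n * W + M * #|miss s| <= M * W)%N.
  elim: n => [|n [[s sn ns]|[s [sn ms]]]].
  - right; exists [::]; split=> //; rewrite mul0n add0n leq_mul2l.
    by rewrite /W -card_ffun max_card orbT.
  - by left; exists s => //; exact: leqW.
  - have [ns|/step[x sx]] := pselect (net s).
      by left; exists s => //; exact: leqW.
    right; exists (x :: s); split=> //; apply: leq_trans ms.
    by rewrite mulSn (addnC W) -addnA leq_add2l.
case: (greedy M.+1) => [[s sM ns]|[s [_]]].
  by exists s; split=> // C cC /andP[_]; exact: ns.
by rewrite mulSn -addnA addnCA -{2}[(M * W)%N]addn0 leq_add2l leqn0 addn_eq0 gtn_eqF.
Qed.

Lemma pq_compact (p : nat) : exists f : nat, forall (I : finType) (K : I -> set E),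
  (forall k, convex_set (K k)) -> (forall k, compact (K k)) ->
  (forall L : 'I_p -> I, exists2 J : 'I_d.+1 -> 'I_p, injective J &
     exists x, forall k, K (L (J k)) x) ->
  exists s : seq E, (size s <= f)%N /\ forall k, exists2 x, x \in s & K k x.
Proof.
pose c := #|{: {ffun 'I_d.+1 -> 'I_p} * 'I_d.+1}|.
have [f net] := weak_net (4 * c); exists f => I K cK kK pK.
have [I0|I0] := posnP #|I|.
  by exists [::]; split=> // k; have := fintype0 k I0.
have heavy (T : finType) (pi : T -> I) (T0 : (0 < #|T|)%N) :=
  @heavy_point p I T K pi cK kK pK T0.
have c0 : (0 < c)%N.
  have [x] := heavy I id I0; rewrite -/c => /(leq_trans I0).
  by rewrite muln_gt0 => /andP[].
have [n [X [n0 hitX]]] := fractional_transversal heavy c0 I0.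
have [s [sf sP]] := net _ X; exists s; split=> // k.
by apply: sP => //; rewrite card_ord n0 hitX.
Qed.

(* Passing to hulls of witnesses for the intersecting (d+1)-tuples makes the
   sets compact without losing any of these intersections. *)
Lemma pq_theorem (p : nat) : exists f : nat, forall (I : finType) (K : I -> set E),
  (forall k, convex_set (K k)) ->
  (forall L : 'I_p -> I, exists2 J : 'I_d.+1 -> 'I_p, injective J &
     exists x, forall k, K (L (J k)) x) ->
  exists s : seq E, (size s <= f)%N /\ forall k, exists2 x, x \in s & K k x.
Proof.
have [f pq] := pq_compact p; exists f => I K cK pK.
pose common (J : {ffun 'I_d.+1 -> I}) x := forall k, K (J k) x.
have /choice[y yP] J : exists y, (exists x, common J x) -> common J y.
  have [[x Jx]|nJ] := pselect (exists x, common J x); first by exists x.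
  by exists 0 => /nJ.
pose S i : pred {ffun 'I_d.+1 -> I} :=
  fun J => (i \in codom J) && `[< exists x, common J x >].
have [||L|s [sf sP]] := pq I (fun i => hull y (S i)).
- by move=> i; exact: hull_convex.
- by move=> i; exact: hull_compact.
- have [J injJ [x Jx]] := pK L; exists J => //.
  pose LJ := [ffun k => L (J k)]; exists (y LJ) => k; apply: hull_in.
  apply/andP; split; first by apply/codomP; exists k; rewrite ffunE.
  by apply/asboolP; exists x => l; rewrite ffunE.
exists s; split=> // k; have [x xs xk] := sP k; exists x => //.
apply: hull_sub xk => // J /andP[/codomP[l ->] /asboolP cJ].
exact: yP.
Qed.

End PqTheorem.

Section Flats.
Variables (R : realType).

Lemma convex_crossing n (K : set 'rV[R]_n) (phi : 'rV[R]_n) (c : R) a b :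
  convex_set K -> K a -> K b -> dot phi a <= c -> c <= dot phi b ->
  exists2 x, K x & dot phi x = c.
Proof.
move=> /convex_setE cK Ka Kb ac cb.
have [e|ne] := eqVneq (dot phi a) (dot phi b).
  by exists a => //; apply/eqP; rewrite eq_le ac e cb.
have ab : 0 < dot phi b - dot phi a.
  by rewrite subr_gt0 lt_neqAle ne (le_trans ac cb).
pose t := (c - dot phi a) / (dot phi b - dot phi a).
exists (t *: b + (1 - t) *: a).
  apply: cK => //; first by rewrite divr_ge0 ?subr_ge0 // ltW // -subr_gt0.
  by rewrite ler_pdivrMr // mul1r lerD2r.
by rewrite dotDr !dotZr /t; field; rewrite gt_eqF.
Qed.

(* Separate [L q] from the intersection of [C] with the other sets: a convex
   set meeting [L q] either crosses the separating hyperplane or lies on the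
   side of [L q], where the remaining [q] sets have no common point. *)
Lemma crossing_hyperplanes n (L : nat -> set 'rV[R]_n) (q : nat) (C : set 'rV[R]_n) :
  convex_set C -> (forall i, convex_set (L i)) ->
  (forall x, C x -> (forall i, (i < q)%N -> L i x) -> False) ->
  exists hs : seq ('rV[R]_n * R), [/\ (size hs <= q)%N,
    forall h, h \in hs -> h.1 != 0 &
    forall K : set 'rV[R]_n, convex_set K -> K !=set0 -> K `<=` C ->
      (forall i, (i < q)%N -> K `&` L i !=set0) ->
      exists2 h, h \in hs & exists2 x, K x & dot h.1 x = h.2].
Proof.
move=> + cL; elim: q C => [|q IH] C cC CL.
  by exists [::]; split=> // K _ [x Kx] KC; have [] := CL x (KC x Kx).
pose M := C `&` \bigcap_(i in [set i | (i < q)%N]) L i.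
have cM : convex_set M by apply: convex_setI => //; apply: convex_bigcap.
have [[x0 Mx0]|M0] := pselect (M !=set0); last first.
  have [|hs [hsq hs0 hsP]] := IH C cC.
    by move=> x Cx Lx; apply: M0; exists x; split.
  exists hs; split=> // [|K cK K0 KC KL]; first exact: leqW.
  by apply: hsP => // i iq; apply: KL; exact: leqW.
have [CLq|CLq] := pselect (C `&` L q !=set0); last first.
  exists [::]; split=> // K _ _ KC KL; have [x [Kx Lx]] := KL q (ltnSn q).
  by case: CLq; exists x; split=> //; exact: KC.
have [||phi [c [phi0 Mc Lc]]] := separation cM (convex_setI cC (cL q)) _ CLq _.
- by exists x0.
- rewrite -subset0 => x [[Cx Mx] [_ Lx]]; apply: (CL x Cx) => i.
  by rewrite ltnS leq_eqVlt => /predU1P[->//|]; exact: Mx.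
pose C' := C `&` [set x | c < dot phi x].
have [||hs [hsq hs0 hsP]] := IH C'.
- apply: convex_setI => //; apply/convex_setE => x y t /= cx cy t0 t1.
  rewrite dotDr !dotZr; have [->|t0'] := eqVneq t 0; first by lra.
  have {t0'} : 0 < t by rewrite lt_neqAle eq_sym t0' t0.
  nra.
- move=> x [Cx cx] Lx; have : dot phi x <= c by apply: Mc; split=> // i; exact: Lx.
  by rewrite leNgt => /negP; apply.
exists ((phi, c) :: hs); split=> // [h|K cK K0 KC KL].
  by rewrite inE => /predU1P[->//|]; exact: hs0.
have [[x Kx xc]|nK] := pselect (exists2 x, K x & dot phi x = c).
  by exists (phi, c); [exact: mem_head|exists x].
have [z [Kz Lz]] := KL q (ltnSn q).
have cz : c <= dot phi z by apply: Lc; split=> //; exact: KC.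
have [||h hhs hK] := hsP K cK K0.
- move=> x Kx; split; first exact: KC.
  rewrite /= ltNge; apply/negP => xc; apply: nK.
  exact: (convex_crossing cK Kx Kz).
- by move=> i iq; apply: KL; exact: leqW.
- by exists h => //; rewrite inE hhs orbT.
Qed.

(* An [n]-flat is given by an affine parametrization, possibly degenerate. *)
Definition flat (n d : nat) : Type := 'M[R]_(n, d) * 'rV[R]_d.

Definition flat_pt n d (f : flat n d) (y : 'rV[R]_n) : 'rV[R]_d :=
  f.2 + y *m f.1.

Definition flat_comp n k d (f : flat k d) (g : flat n k) : flat n d :=
  (g.1 *m f.1, flat_pt f g.2).

Lemma flat_compE n k d (f : flat k d) (g : flat n k) y :
  flat_pt (flat_comp f g) y = flat_pt f (flat_pt g y).
Proof. by rewrite /flat_pt /= mulmxDl addrA mulmxA. Qed.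

Lemma flat_preimage_convex n d (f : flat n d) (K : set 'rV[R]_d) :
  convex_set K -> convex_set (flat_pt f @^-1` K).
Proof.
move=> /convex_setE cK; apply/convex_setE => x y t Kx Ky t0 t1.
rewrite /preimage /=; have -> : flat_pt f (t *: x + (1 - t) *: y) =
    t *: flat_pt f x + (1 - t) *: flat_pt f y; last exact: cK.
rewrite /flat_pt mulmxDl -!scalemxAl !scalerDr addrACA -scalerDl.
by rewrite (addrC t) subrK scale1r.
Qed.

Lemma hyperplane_flat n (phi : 'rV[R]_n.+1) (c : R) : phi != 0 ->
  exists f : flat n n.+1, forall x, dot phi x = c -> exists y, x = flat_pt f y.
Proof.
move=> phi0; pose B := kermx phi^T; pose q := (c / sqn phi) *: phi.
have rB : \rank B = n.
  by rewrite mxrank_ker mxrank_tr rank_rV phi0 subn1.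
have [A BA] : exists A : 'M[R]_(n, n.+1), (B <= A)%MS.
  move: (row_base B) (eq_row_base B); rewrite rB => A eA.
  by exists A; rewrite eA.
exists (A, q) => x xc; have /submxP[y xy] : (x - q <= A)%MS.
  apply: submx_trans BA; apply/sub_kermxP/matrixP => i j; rewrite !ord1 [RHS]mxE.
  have -> : ((x - q) *m phi^T) 0 0 = dot phi (x - q).
    by rewrite mxE dotC; apply: eq_bigr => k _; rewrite !mxE.
  rewrite dotBr xc dotZr divfK ?subrr //.
  by apply: contra phi0 => /eqP/sqn_eq0 ->.
by exists y; rewrite /flat_pt /= -xy addrC subrK.
Qed.

Lemma step_down n d p (fs : seq (flat n.+1 d)) (L : 'I_p -> set 'rV[R]_d) :
  (size fs * d < p)%N -> (forall k, convex_set (L k)) ->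
  (forall J : 'I_d.+1 -> 'I_p, injective J ->
     ~ exists x, forall k, L (J k) x) ->
  exists gs : seq (flat n d), (size gs <= size fs * (p ^ d.+1 * d.+1))%N /\
    forall M : set 'rV[R]_d, convex_set M ->
      (forall k, exists2 f, f \in fs & exists y, (M `&` L k) (flat_pt f y)) ->
      exists2 g, g \in gs & exists y, M (flat_pt g y).
Proof.
move=> fsp cL nL.
have /choice[G GP] (fJ : flat n.+1 d * {ffun 'I_d.+1 -> 'I_p}) :
    exists gs : seq (flat n d), (size gs <= d.+1)%N /\
    (injective fJ.2 -> forall M : set 'rV[R]_d, convex_set M ->
      (forall k, exists y, (M `&` L (fJ.2 k)) (flat_pt fJ.1 y)) ->
      exists2 g, g \in gs & exists y, M (flat_pt g y)).
  case: fJ => f J /=.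
  have [injJ|nJ] := pselect (injective J); last by exists [::]; split=> // /nJ.
  pose L' i := flat_pt f @^-1` L (J (inord i)).
  have [||x _ Lx|hs [hsd hs0 hsP]] := @crossing_hyperplanes n.+1 L' d.+1 setT.
  - by apply/convex_setE.
  - by move=> i; apply: flat_preimage_convex.
  - apply: (nL J injJ); exists (flat_pt f x) => k.
    by have := Lx k (ltn_ord k); rewrite /L' /preimage /= inord_val.
  have /choice[H HP] (h : 'rV[R]_n.+1 * R) : exists g : flat n n.+1,
      h.1 != 0 -> forall x, dot h.1 x = h.2 -> exists y, x = flat_pt g y.
    have [->|h0] := eqVneq h.1 0; first by exists (0, 0).
    by have [g gP] := hyperplane_flat h.2 h0; exists g.
  exists [seq flat_comp f (H h) | h <- hs]; split; first by rewrite size_map.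
  move=> _ M cM ML.
  have [||||h hhs [x Mx xh]] := hsP (flat_pt f @^-1` M).
  - exact: flat_preimage_convex.
  - by have [y [My _]] := ML ord0; exists y.
  - by [].
  - move=> i iq; have [y [My Ly]] := ML (inord i).
    by exists y.
  have [y xy] := HP h (hs0 h hhs) x xh.
  exists (flat_comp f (H h)); first exact: map_f.
  by exists y; rewrite flat_compE -xy.
pose pairs := [seq (f, J) | f <- fs, J <- enum {: {ffun 'I_d.+1 -> 'I_p}}].
exists (flatten (map G pairs)); split.
  rewrite size_flatten sumnE !big_map.
  apply: (@leq_trans (\sum_(x <- pairs) d.+1)%N).
    by apply: leq_sum => x _; exact: (GP x).1.
  rewrite big_const_seq count_predT size_allpairs iter_addn_0 -cardE card_ffun.
  by rewrite !card_ord mulnC -mulnA.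
move=> M cM Mfs.
have /choice[i iP] k : exists i : 'I_(size fs),
    exists y, (M `&` L k) (flat_pt (tnth (in_tuple fs) i) y).
  by have [f /seq_tnthP[i ->] fy] := Mfs k; exists i.
have p0 : (0 < #|'I_p|)%N by rewrite card_ord; exact: leq_ltn_trans fsp.
have [|c] := @pigeonhole _ _ (fun c : 'I_(size fs) => [pred k | i k == c]) _ p0.
  by move=> k; exists (i k) => /=.
rewrite !card_ord => /(leq_trans fsp); rewrite ltn_mul2l => /andP[_ dc].
pose J := [ffun k => enum_val (widen_ord dc k)].
have injJ : injective J.
  by move=> k l; rewrite !ffunE => /enum_val_inj /(congr1 val) /= kl; exact: val_inj.
have Jc k : i (J k) = c.
  by rewrite ffunE; apply/eqP; exact: (enum_valP (widen_ord dc k)).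
pose f := tnth (in_tuple fs) c.
have [k|g ggs gM] := (GP (f, J)).2 injJ M cM.
  by have [y] := iP (J k); rewrite Jc => fy; exists y.
exists g => //; apply/flattenP; exists (G (f, J)) => //; apply: map_f.
by apply/allpairsP; exists (f, J); rewrite mem_tnth mem_enum.
Qed.

End Flats.

Section Families.
Variables (R : realType) (d : nat).
Local Notation E := 'rV[R]_d.

Lemma pq_family (p : nat) : exists f : nat, forall G : set (set E),
  finite_set G -> (forall K, G K -> convex_set K) -> ~ pierced_by_points f G ->
  exists L : 'I_p -> set E, (forall k, G (L k)) /\
    forall J : 'I_d.+1 -> 'I_p, injective J -> ~ exists x, forall k, L (J k) x.
Proof.
have [f pq] := pq_theorem R d p; exists f => G /finite_seqP[s ->] cG nG.
pose K := tnth (in_tuple s).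
apply: contrapT => noL; apply: nG.
have [k|L|t [tf tP]] := pq _ K.
- by apply: cG; exact: mem_tnth.
- apply: contrapT => noJ; apply: noL; exists (K \o L); split=> [k|J injJ Jx].
    exact: mem_tnth.
  by apply: noJ; exists J.
exists (nth 0 t @` `I_f); split; first exact: card_image_le.
move=> C /seq_tnthP[k ->]; have [x xt Kx] := tP k.
exists x => //; exists (index x t); last exact: nth_index.
by rewrite /= (leq_trans _ tf) // index_mem.
Qed.

Lemma pierced_by_points_le (m n : nat) (G : set (set E)) :
  (m <= n)%N -> pierced_by_points m G -> pierced_by_points n G.
Proof.
move=> mn [X [Xm GX]]; exists X; split=> //; apply: card_le_trans Xm _.
by apply: subset_card_le => k /= km; exact: leq_trans mn.
Qed.

Fixpoint flat_count (t : nat) : nat :=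
  if t is t'.+1 then
    (flat_count t' * ((flat_count t' * d).+1 ^ d.+1 * d.+1))%N
  else 1%N.

Lemma flats_exist (F : 'I_d.+1 -> set (set E)) (s : seq 'I_d.+1) (n : nat) :
  (forall K, colored_family F K -> convex_set K) -> colorful_helly F ->
  (n + size s = d)%N -> uniq s ->
  (forall j t, j \in s -> (t < size s)%N ->
     exists L : 'I_(flat_count t * d).+1 -> set E, (forall k, F j (L k)) /\
     forall J : 'I_d.+1 -> 'I_(flat_count t * d).+1, injective J ->
       ~ exists x, forall k, L (J k) x) ->
  exists fs : seq (flat R n d), (size fs <= flat_count (size s))%N /\
    forall K, (forall l, F l (K l)) -> exists2 f, f \in fs &
      exists y, forall l, l \notin s -> K l (flat_pt f y).
Proof.
move=> cF CH; elim: s n => [|j s IH] n.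
  rewrite /= addn0 => nd _ _; rewrite nd.
  exists [:: (1%:M, 0)]; split=> // K KF; have [x Kx] := CH K KF.
  exists (1%:M, 0); first exact: mem_head.
  by exists x => l _; rewrite /flat_pt /= mulmx1 add0r; exact: Kx.
move=> nd /andP[js us] LP.
have [||k t ks ts|fs [fss fsP]] := IH n.+1.
- by move: nd => /=; rewrite addnS.
- by [].
- by apply: LP; [rewrite inE ks orbT|exact: leqW].
have [L [LF nL]] := LP j (size s) (mem_head _ _) (ltnSn _).
have cL k : convex_set (L k) by apply: cF; exists j.
have fsp : (size fs * d < (flat_count (size s) * d).+1)%N.
  by rewrite ltnS leq_mul2r fss orbT.
have [gs [gss gsP]] := step_down fsp cL nL.
exists gs; split; first by rewrite (leq_trans gss) //= leq_mul2r fss orbT.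
move=> K KF.
have [||g ggs [y gy]] := gsP (\bigcap_(l in [set l | l \notin j :: s]) K l).
- by apply: convex_bigcap => l _; apply: cF; exists l.
- move=> k; pose Kk l := if l == j then L k else K l.
  have [l|f ffs [y fy]] := fsP Kk; first by rewrite /Kk; case: eqP => [->|].
  exists f => //; exists y; split=> [l /=|].
    rewrite inE negb_or => /andP[lj ls].
    by have := fy l ls; rewrite /Kk (negbTE lj).
  by have := fy j js; rewrite /Kk eqxx.
by exists g => //; exists y.
Qed.

Lemma line_of_flat (f : flat R 1 d) : (0 < d)%N ->
  exists2 l, is_line l & forall y, l (flat_pt f y).
Proof.
move=> d0; pose v := row 0 f.1.
have fE y : flat_pt f y = f.2 + y 0 0 *: v.
  by congr (_ + _); apply/rowP => k; rewrite !mxE big_ord1.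
have [v0|v0] := eqVneq v 0.
  pose w : 'rV[R]_d := const_mx 1.
  have w0 : w != 0.
    apply/eqP => /rowP/(_ (Ordinal d0)); rewrite !mxE => /eqP.
    by rewrite oner_eq0.
  exists [set f.2 + t *: w | t in [set: R]]; first by exists f.2, w.
  by move=> y; exists 0 => //; rewrite fE v0 scaler0 scale0r.
exists [set f.2 + t *: v | t in [set: R]]; first by exists f.2, v.
by move=> y; exists (y 0 0) => //; rewrite fE.
Qed.

End Families.

Theorem theorem6 (R : realType) (d : nat) (hd : (2 <= d)%N) :
  exists f g : nat,
    forall (F : 'I_d.+1 -> set (set 'rV[R]_d)),
      finite_set (colored_family F) ->
      (forall K, colored_family F K -> convex_set K) ->
      colorful_helly F ->
      forall i : 'I_d.+1,
        F i !=set0 ->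
        \bigcap_(K in F i) K !=set0 ->
        (exists j : 'I_d.+1, j != i /\ pierced_by_points f (F j)) \/
        crossed_by_lines g (colored_family F).
Proof.
have d0 : (0 < d)%N by exact: ltnW.
have /choice[pq pqP] := @pq_family R d.
pose f := (\sum_(t < d) pq (flat_count d t * d).+1)%N.
pose N := flat_count d d.-1.
exists f, (1 + N * d.+1)%N => F finF cF CH i [Ki FKi] [p pP].
have [|nF] := pselect (exists j : 'I_d.+1, j != i /\ pierced_by_points f (F j)).
  by left.
right.
have nFj j : j != i -> ~ pierced_by_points f (F j).
  by move=> ji pj; apply: nF; exists j.
have /choice[K0 FK0] l : exists K, F l K.
  have [->|li] := eqVneq l i; first by exists Ki.
  apply: contrapT => nK; apply: (nFj l li); exists set0; split=> // K FK.
  by case: nK; exists K.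
have bad j t : j != i -> (t < d)%N ->
    exists L : 'I_(flat_count d t * d).+1 -> set 'rV[R]_d,
      (forall k, F j (L k)) /\
      forall J : 'I_d.+1 -> 'I_(flat_count d t * d).+1, injective J ->
        ~ exists x, forall k, L (J k) x.
  move=> ji td; apply: pqP.
  - by apply: sub_finite_set finF => K FK; exists j.
  - by move=> K FK; apply: cF; exists j.
  - apply: contra_not (nFj j ji); apply: pierced_by_points_le.
    by rewrite /f (bigD1 (Ordinal td)) //= leq_addr.
pose others j0 := enum [pred j | (j != i) && (j != j0)].
have size_others j0 : j0 != i -> size (others j0) = d.-1.
  move=> j0i; rewrite -cardE.
  rewrite (eq_card (B := [predC pred2 i j0])) => [|j].
    have := cardC (pred2 i j0); rewrite card2 card_ord eq_sym j0i /=.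
    by rewrite add2n => -[] /(congr1 predn).
  by rewrite !inE negb_or.
have /choice[ls lsP] j0 : exists ls : seq (set 'rV[R]_d), (size ls <= N)%N /\
    (forall l, l \in ls -> is_line l) /\
    (j0 != i -> forall K, F j0 K -> exists2 l, l \in ls & l `&` K !=set0).
  have [->|j0i] := eqVneq j0 i; first by exists [::].
  have [|||fs [fsN fsP]] := @flats_exist R d F (others j0) 1 cF CH.
  - by rewrite size_others // add1n prednK.
  - exact: enum_uniq.
  - move=> j t; rewrite mem_enum inE => /andP[ji _] ts; apply: bad => //.
    by rewrite (leq_trans ts) // size_others // leq_pred.
  have /choice[ln lnP] (fl : flat R 1 d) :
      exists l, is_line l /\ forall y, l (flat_pt fl y).
    by have [l ? ?] := line_of_flat fl d0; exists l.
  exists (map ln fs); split; first by rewrite size_map /N -(size_others j0).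
  split=> [_ /mapP[fl _ ->]|_ K FK]; first exact: (lnP fl).1.
  have [l|fl fls [y fly]] := fsP (fun l => if l == j0 then K else K0 l).
    by case: eqP => [->|_].
  exists (ln fl); first exact: map_f.
  exists (flat_pt fl y); split; first exact: (lnP fl).2.
  have := fly j0; rewrite eqxx; apply.
  by rewrite mem_enum inE eqxx andbF.
pose v : 'rV[R]_d := const_mx 1.
have v0 : v != 0.
  by apply/eqP => /rowP/(_ (Ordinal d0)) /eqP; rewrite !mxE oner_eq0.
pose l0 := [set p + t *: v | t in [set: R]].
have l0P : is_line l0 by exists p, v.
pose all_lines := l0 :: flatten [seq ls j | j <- index_enum 'I_d.+1].
have size_lines : (size all_lines <= 1 + N * d.+1)%N.
  rewrite /= -add1n leq_add2l size_flatten sumnE !big_map.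
  apply: (@leq_trans (\sum_(j < d.+1) N)%N).
    by apply: leq_sum => j _; exact: (lsP j).1.
  by rewrite sum_nat_const card_ord mulnC.
have linesP l : l \in all_lines -> is_line l.
  rewrite inE => /predU1P[->//|/flattenP[_ /mapP[j _ ->] lj]].
  exact: (lsP j).2.1.
exists (nth l0 all_lines @` `I_(1 + N * d.+1)); split.
- exact: card_image_le.
- move=> _ [k _ <-]; have [ks|ks] := ltnP k (size all_lines).
    by apply: linesP; exact: mem_nth.
  by rewrite nth_default.
move=> K [j _ FK].
have [l lin lK] : exists2 l, l \in all_lines & l `&` K !=set0.
  have [ji|ji] := eqVneq j i.
    exists l0; first exact: mem_head.
    exists p; split; last by apply: pP; rewrite -ji.
    by exists 0 => //; rewrite scale0r addr0.
  have [l lj lK] := (lsP j).2.2 ji K FK; exists l => //.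
  rewrite inE; apply/orP; right; apply/flattenP; exists (ls j) => //.
  by apply: map_f; rewrite mem_index_enum.
exists l => //; exists (index l all_lines); last exact: nth_index.
by apply: leq_trans size_lines; rewrite index_mem.
Qed.
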